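(* Let $K$ be a field of characteristic $p>0$ and $K(z)=K(z_1,\dots,z_n)$. The map $\gamma_0:\Omega^*_{K(z)/K}\to H^*_{K(z)}$ given in each degree $r$ by $$\gamma_0\Big(\sum_I a_I(z)\,dz_I\Big)=\sum_I a_I(z^p)\,z_I^{p-1}\,dz_I \mod B^r_{K(z)}$$ is an isomorphism of $K(z)$-vector spaces, where $K(z)$ acts on $H^*_{K(z)}$ via the ring homomorphism $F_0:K(z)\to K(z)$, $a(z)\mapsto a(z^p)$.
   Context: $\Omega^r_{K(z)/K}$ is the $K(z)$-vector space of rational differential $r$-forms, with basis $dz_I=dz_{i_1}\wedge\cdots\wedge dz_{i_r}$ for $I=(i_1<\cdots<i_r)$; $\Omega^*_{K(z)/K}=\bigoplus_r\Omega^r_{K(z)/K}$. $d$ is the exterior derivative. $Z^r_{K(z)}=\{\alpha\in\Omega^r_{K(z)/K}: d\alpha=0\}$, $B^r_{K(z)}=\{d\alpha:\alpha\in\Omega^{r-1}_{K(z)/K}\}$ (so $B^0_{K(z)}=0$), $H^r_{K(z)}=Z^r_{K(z)}/B^r_{K(z)}$ and $H^*_{K(z)}=\bigoplus_r H^r_{K(z)}$. For $a\in K(z)$, $a(z^p):=a(z_1^p,\dots,z_n^p)$ (coefficients in $K$ are left unchanged). For $I=(i_1<\cdots<i_r)$, $z_I^{p-1}:=z_{i_1}^{p-1}\cdots z_{i_r}^{p-1}$. The action of $K(z)$ on $H^*_{K(z)}$ via $F_0$ means $a\cdot[\alpha]=[a(z^p)\alpha]$. *)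

(* Defs.v *)
From HB Require Import structures.
From mathcomp Require Import all_boot all_order all_algebra.
From mathcomp Require Import boolp ring.
From mathcomp.multinomials Require Import mpoly.

Set Implicit Arguments.
Unset Strict Implicit.
Unset Printing Implicit Defensive.

Import GRing.Theory.
Local Open Scope ring_scope.
Local Open Scope quotient_scope.

Notation "x %:F" := (@FracField.tofrac _ x) : ring_scope.

Section Fractions.
Variable R : idomainType.
Implicit Types (x y : R) (f g : {fraction R}).

Definition numf f : R := \n_(repr f).
Definition denf f : R := \d_(repr f).

Lemma denf_neq0 f : denf f != 0.
Proof. exact: denom_ratioP. Qed.

Lemma pi_Ratio x y : y != 0 -> \pi_{fraction R} (Ratio x y) = x%:F / y%:F.
Proof.
move=> y0; apply: (canRL (mulfK _)); first by rewrite tofrac_eq0.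
unlock FracField.tofrac; rewrite -[LHS]FracField.pi_mul.
apply/eqmodP; rewrite /= FracField.equivfE /FracField.mulf.
by rewrite !numden_Ratio ?mulf_neq0 ?oner_neq0 // !mulr1 mulrC.
Qed.

Lemma numdenf f : f = (numf f)%:F / (denf f)%:F.
Proof. by rewrite -pi_Ratio ?denf_neq0 // Ratio_numden reprK. Qed.

Lemma divF_eq x y x' y' : y != 0 -> y' != 0 ->
  (x%:F / y%:F == x'%:F / y'%:F :> {fraction R}) = (x * y' == x' * y).
Proof.
by move=> y0 y'0; rewrite eqr_div ?tofrac_eq0 // -!tofracM tofrac_eq.
Qed.

Lemma divFD x y x' y' : y != 0 -> y' != 0 ->
  x%:F / y%:F + x'%:F / y'%:F = (x * y' + x' * y)%:F / (y * y')%:F :> {fraction R}.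
Proof. by move=> y0 y'0; rewrite addf_div ?tofrac_eq0 // tofracD !tofracM. Qed.

Lemma divFM x y x' y' :
  (x%:F / y%:F) * (x'%:F / y'%:F) = (x * x')%:F / (y * y')%:F :> {fraction R}.
Proof. by rewrite mulf_div !tofracM. Qed.

Lemma fracW (P : {fraction R} -> Prop) :
  (forall x y, y != 0 -> P (x%:F / y%:F)) -> forall f, P f.
Proof. by move=> H f; rewrite [f]numdenf; apply: H; apply: denf_neq0. Qed.

End Fractions.

(* The extension of a derivation D of R to its field of fractions, by the
   quotient rule. *)
Section FracDerivation.
Variables (R : idomainType) (D : R -> R).

Definition fracder (f : {fraction R}) : {fraction R} :=
  (D (numf f) * denf f - numf f * D (denf f))%:F / (denf f ^+ 2)%:F.

Hypothesis DD : {morph D : x y / x + y}.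
Hypothesis DM : forall x y, D (x * y) = D x * y + x * D y.

Lemma fracder_div x y : y != 0 ->
  fracder (x%:F / y%:F) = (D x * y - x * D y)%:F / (y ^+ 2)%:F.
Proof.
move=> y0; set f := _ / _; have d0 := denf_neq0 f.
have /eqP := numdenf f; rewrite {1}/f divF_eq // => /eqP e.
have := congr1 D e; rewrite !DM => e'.
rewrite /fracder; apply/eqP; rewrite divF_eq ?expf_neq0 //; apply/eqP.
move: (numf f) (denf f) d0 e e' => a b b0 e e'.
apply/eqP; rewrite -subr_eq0.
have -> : (D a * b - a * D b) * y ^+ 2 - (D x * y - x * D y) * b ^+ 2 =
  b * y * ((D a * y + a * D y) - (D x * b + x * D b)) -
  (y * D b + b * D y) * (a * y - x * b) by ring.
by rewrite e e' !subrr !mulr0 subr0.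
Qed.

Lemma fracderD : {morph fracder : f g / f + g}.
Proof.
elim/fracW=> a b b0; elim/fracW=> c d d0.
rewrite divFD // !fracder_div ?mulf_neq0 // divFD ?expf_neq0 //.
apply/eqP; rewrite divF_eq ?mulf_neq0 ?expf_neq0 ?mulf_neq0 //.
by rewrite !DD !DM; apply/eqP; ring.
Qed.

Lemma fracderM f g : fracder (f * g) = fracder f * g + f * fracder g.
Proof.
elim/fracW: f => a b b0; elim/fracW: g => c d d0.
rewrite divFM // !fracder_div ?mulf_neq0 // !divFM divFD ?mulf_neq0 ?expf_neq0 //.
apply/eqP; rewrite divF_eq ?mulf_neq0 ?expf_neq0 ?mulf_neq0 //.
by rewrite !DM; apply/eqP; ring.
Qed.

End FracDerivation.

(* The extension of an injective endomorphism phi of R to its field of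
   fractions. *)
Section FracMorphism.
Variables (R : idomainType) (phi : {rmorphism R -> R}).

Definition fracmor (f : {fraction R}) : {fraction R} :=
  (phi (numf f))%:F / (phi (denf f))%:F.

Hypothesis phi_inj : forall x, phi x = 0 -> x = 0.

Let phi_neq0 y : y != 0 -> phi y != 0.
Proof. by apply: contra_neq => /phi_inj. Qed.

Lemma fracmor_div x y : y != 0 ->
  fracmor (x%:F / y%:F) = (phi x)%:F / (phi y)%:F.
Proof.
move=> y0; set f := _ / _; have d0 := denf_neq0 f.
have /eqP := numdenf f; rewrite {1}/f divF_eq // => /eqP e.
apply/eqP; rewrite divF_eq ?phi_neq0 //.
by rewrite -!rmorphM e.
Qed.

Lemma fracmor_is_zmod_morphism : zmod_morphism fracmor.
Proof.
elim/fracW=> a b b0; elim/fracW=> c d d0.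
have divFN (x y : R) : - (x%:F / y%:F) = (- x)%:F / y%:F :> {fraction R}.
  by rewrite tofracN mulNr.
rewrite divFN divFD // !fracmor_div ?mulf_neq0 // divFN divFD ?phi_neq0 //.
by rewrite rmorphD !rmorphM /= rmorphN.
Qed.

Lemma fracmor_is_monoid_morphism : monoid_morphism fracmor.
Proof.
split.
  have -> : (1 : {fraction R}) = 1%:F / 1%:F by rewrite tofrac1 divr1.
  by rewrite fracmor_div ?oner_neq0 // rmorph1.
elim/fracW=> a b b0; elim/fracW=> c d d0.
by rewrite divFM !fracmor_div ?mulf_neq0 // divFM !rmorphM.
Qed.

End FracMorphism.

(* The field K(z) = K(z_1, ..., z_n). *)
Notation ratfun K n := {fraction {mpoly K[n]}}.

Section RationalFunctions.
Variables (K : fieldType) (n : nat).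
Local Notation Kz := (ratfun K n).
Implicit Types (f g : Kz) (i : 'I_n).

Definition zvar i : Kz := ('X_i : {mpoly K[n]})%:F.

Definition pderiv i : Kz -> Kz := fracder (@mderiv n K i).

Lemma pderiv_is_zmod_morphism i : zmod_morphism (pderiv i).
Proof.
have D := fracderD (@mderivD n K i) (@mderivM n K i).
move=> f g; apply: (addIr (pderiv i g)); rewrite subrK.
by rewrite /pderiv -D subrK.
Qed.

HB.instance Definition _ i :=
  GRing.isZmodMorphism.Build Kz Kz (pderiv i) (pderiv_is_zmod_morphism i).

Lemma pderivM i f g : pderiv i (f * g) = pderiv i f * g + f * pderiv i g.
Proof. exact: fracderM (@mderivM n K i) f g. Qed.

Variable p : nat.

Definition powsubst : {mpoly K[n]} -> {mpoly K[n]} :=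
  comp_mpoly [tuple 'X_i ^+ p | i < n].

HB.instance Definition _ := GRing.RMorphism.on powsubst.

Lemma powsubstX (m : 'X_{1..n}) : powsubst 'X_[m] = 'X_[m *+ p].
Proof.
rewrite /powsubst comp_mpolyX mpolyXE_id.
by apply: eq_bigr => i _; rewrite tnth_mktuple mulmnE mulnC exprM.
Qed.

Lemma powsubstE x : powsubst x = \sum_(m <- msupp x) x@_m *: 'X_[m *+ p].
Proof.
rewrite {1}(mpolyE x) raddf_sum; apply: eq_bigr => m _.
by rewrite [LHS]comp_mpolyZ; congr (_ *: _); apply: powsubstX.
Qed.

Lemma powsubst_inj : (0 < p)%N -> forall x, powsubst x = 0 -> x = 0.
Proof.
move=> p0 x /mpolyP x0; apply/mpolyP => m; have := x0 (m *+ p)%MM.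
rewrite !mcoeff0 => <-; rewrite powsubstE [in LHS](mpolyE x) !raddf_sum /=.
apply: eq_bigr => k _; rewrite !mcoeffZ !mcoeffX; congr (_ * _%:R).
congr nat_of_bool; apply/eqP/eqP => [-> //|/mnmP e]; apply/mnmP => i.
by apply/eqP; have /eqP := e i; rewrite !mulmnE eqn_pmul2r.
Qed.

Lemma mderiv_powsubst i x : p \in [pchar K] -> (powsubst x)^`M(i) = 0.
Proof.
move=> charKp; rewrite powsubstE raddf_sum /= big1 // => m _.
rewrite mderivZ mderivX mulmnE natrM.
by rewrite (pcharf0 charKp) mulr0 scale0r scaler0.
Qed.

(* The ring homomorphism a(z) |-> a(z^p).  The hypothesis on p is used only
   through p > 0: for p = 0 the substitution z |-> z^p does not extend to
   K(z). *)
Definition F0 of p \in [pchar K] : Kz -> Kz := fracmor powsubst.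

Variable charKp : p \in [pchar K].

Lemma F0_is_zmod_morphism : zmod_morphism (F0 charKp).
Proof.
by apply/fracmor_is_zmod_morphism/powsubst_inj/prime_gt0/(pcharf_prime charKp).
Qed.

Lemma F0_is_monoid_morphism : monoid_morphism (F0 charKp).
Proof.
by apply/fracmor_is_monoid_morphism/powsubst_inj/prime_gt0/(pcharf_prime charKp).
Qed.

HB.instance Definition _ :=
  GRing.isZmodMorphism.Build Kz Kz (F0 charKp) F0_is_zmod_morphism.
HB.instance Definition _ :=
  GRing.isMonoidMorphism.Build Kz Kz (F0 charKp) F0_is_monoid_morphism.

Lemma pderiv_F0 i f : pderiv i (F0 charKp f) = 0.
Proof.
rewrite /pderiv fracder_div; last 2 first.
- exact: mderivM.
- have := denf_neq0 f; apply: contra_neq; apply: powsubst_inj.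
  exact: prime_gt0 (pcharf_prime charKp).
by rewrite !mderiv_powsubst // mul0r mulr0 subrr tofrac0 mul0r.
Qed.

Lemma pderiv_zvar i j k : i != j -> pderiv i (zvar j ^+ k) = 0.
Proof.
move=> ij; have -> : zvar j ^+ k = ('X_j ^+ k)%:F / 1%:F.
  by rewrite tofrac1 divr1 tofracXn.
rewrite /pderiv fracder_div ?oner_neq0 //; last exact: mderivM.
rewrite mpolyXn mderivX mulmnE mnm1E eq_sym (negPf ij) mul0n scale0r.
by rewrite -mpolyC1 mderivC mul0r mulr0 subrr tofrac0 mul0r.
Qed.

End RationalFunctions.

Section Forms.
Variables (K : fieldType) (n : nat).
Local Notation Kz := (ratfun K n).

(* A multiindex i_1 < ... < i_r is represented by the set {i_1, ..., i_r}. *)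
Definition multiindex r := {I : {set 'I_n} | #|I| == r}.

Definition diff_form r := {ffun multiindex r -> Kz^o}.
HB.instance Definition _ r := GRing.Lmodule.on (diff_form r).

(* The basis form dz_I, for #|I| = r. *)
Definition dz r (I : {set 'I_n}) : diff_form r := [ffun J => (val J == I)%:R].

Lemma form_dz r (a : diff_form r) : a = \sum_I a I *: dz r (val I).
Proof.
apply/ffunP => J; rewrite sum_ffunE (bigD1 J) //=.
rewrite [X in _ = X + _]ffunE ffunE eqxx big1 => [|I IJ].
  by rewrite addr0; exact: esym (mulr1 _).
rewrite ffunE ffunE; rewrite -val_eqE eq_sym in IJ.
rewrite (negPf IJ); exact: scaler0.
Qed.

(* dz_j /\ dz_I, where I has r elements. *)
Definition wedge_dz r (j : 'I_n) (I : {set 'I_n}) : diff_form r.+1 :=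
  if j \in I then 0
  else (-1) ^+ #|[set i in I | (i < j)%N]| *: dz r.+1 (j |: I).

(* d (\sum_I a_I dz_I) = \sum_I \sum_j (da_I / dz_j) dz_j /\ dz_I. *)
Definition ext_deriv r (a : diff_form r) : diff_form r.+1 :=
  \sum_(I : multiindex r) \sum_(j < n) pderiv j (a I) *: wedge_dz r j (val I).

Lemma ext_deriv_is_zmod_morphism r : zmod_morphism (@ext_deriv r).
Proof.
move=> a b; rewrite /ext_deriv -sumrB; apply: eq_bigr => I _.
rewrite -sumrB; apply: eq_bigr => j _.
by rewrite -scalerBl -raddfB !ffunE.
Qed.

HB.instance Definition _ r :=
  GRing.isZmodMorphism.Build (diff_form r) (diff_form r.+1) (@ext_deriv r)
    (@ext_deriv_is_zmod_morphism r).

Definition is_closed r : {pred diff_form r} := fun a => ext_deriv a == 0.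

Lemma closed_zmod_closed r : zmod_closed (@is_closed r).
Proof.
split=> [|a b]; first by rewrite unfold_in raddf0.
rewrite unfold_in => /eqP a0; rewrite unfold_in => /eqP b0.
by rewrite unfold_in ext_deriv_is_zmod_morphism a0 b0 subrr.
Qed.

HB.instance Definition _ r :=
  GRing.isZmodClosed.Build (diff_form r) (@is_closed r) (@closed_zmod_closed r).

(* Z^r *)
Record closed_form r :=
  ClosedForm { cf_val :> diff_form r; _ : cf_val \in @is_closed r }.
HB.instance Definition _ r := [isSub for @cf_val r].
HB.instance Definition _ r := [Choice of closed_form r by <:].
HB.instance Definition _ r := [SubChoice_isSubZmodule of closed_form r by <:].

(* B^r, first as a predicate on r-forms and then as a subset of Z^r. *)
Definition is_exact r : diff_form r -> Prop :=
  match r with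
  | 0 => fun a => a = 0
  | s.+1 => fun a => exists b : diff_form s, a = ext_deriv b
  end.

Definition exact_closed r : {pred closed_form r} := fun a => `[< is_exact (cf_val a) >].

Lemma exact_zmod_closed r : zmod_closed (@exact_closed r).
Proof.
split=> [|a b]; rewrite !unfold_in.
  by apply/asboolP; case: r => [//|r]; exists 0; rewrite raddf0.
move=> /asboolP ea /asboolP eb; apply/asboolP.
have -> : cf_val (a - b) = cf_val a - cf_val b by [].
case: r a b ea eb => [|r] a b /=; first by move=> -> ->; rewrite subrr.
by move=> [a' ->] [b' ->]; exists (a' - b'); rewrite ext_deriv_is_zmod_morphism.
Qed.

HB.instance Definition _ r :=
  GRing.isZmodClosed.Build (closed_form r) (@exact_closed r) (@exact_zmod_closed r).

(* H^r = Z^r / B^r *)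
Definition cohom r := Quotient.quot (@exact_closed r).
HB.instance Definition _ r := GRing.Zmodule.on (cohom r).

Definition coclass r (a : closed_form r) : cohom r := \pi_(cohom r) a.

Lemma coclassP r (a b : closed_form r) :
  reflect (coclass a = coclass b) (a - b \in @exact_closed r).
Proof. by rewrite Quotient.idealrBE; apply: eqP. Qed.

Lemma coclassW r (P : cohom r -> Prop) :
  (forall a, P (coclass a)) -> forall h, P h.
Proof. by move=> H; apply: quotW. Qed.

Lemma coclassD r : {morph @coclass r : a b / a + b}.
Proof. by move=> a b; exact: Quotient.pi_add. Qed.

End Forms.

Section FrobeniusAction.
Variables (K : fieldType) (p : nat) (charKp : p \in [pchar K]) (n : nat).
Local Notation Kz := (ratfun K n).
Local Notation F0 := (@F0 K n p charKp).

Lemma ext_deriv_F0 r (c : Kz) (a : diff_form K n r) :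
  ext_deriv (F0 c *: a) = F0 c *: ext_deriv a.
Proof.
rewrite /ext_deriv scaler_sumr; apply: eq_bigr => I _.
rewrite scaler_sumr; apply: eq_bigr => j _; rewrite scalerA; congr (_ *: _).
by rewrite ffunE [LHS]pderivM pderiv_F0 mul0r add0r.
Qed.

Lemma closed_F0 r (c : Kz) (a : closed_form K n r) :
  F0 c *: cf_val a \in @is_closed K n r.
Proof.
by case: a => a /=; rewrite !unfold_in => /eqP a0; rewrite ext_deriv_F0 a0 scaler0.
Qed.

(* c . a = c(z^p) a *)
Definition F0_scale r (c : Kz) (a : closed_form K n r) : closed_form K n r :=
  ClosedForm (closed_F0 c a).

Lemma exact_F0 r (c : Kz) (a : closed_form K n r) :
  a \in @exact_closed K n r -> F0_scale c a \in @exact_closed K n r.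
Proof.
rewrite !unfold_in => /asboolP ea; apply/asboolP.
case: r a ea => [|r] a /=; first by move=> ->; rewrite scaler0.
by move=> [b ->]; exists (F0 c *: b); rewrite ext_deriv_F0.
Qed.

(* H^r with the action of K(z) via F_0: the same abelian group as cohom, under
   a name on which the hypothesis on p selects the module structure. *)
Definition cohomF0 of p \in [pchar K] := fun r => cohom K n r.
Local Notation H r := (cohomF0 charKp r).

HB.instance Definition _ r := GRing.Zmodule.on (H r).

Definition cohom_scale r (c : Kz) (h : H r) : H r :=
  coclass (F0_scale c (repr (h : cohom K n r))).

Lemma cohom_scaleE r (c : Kz) (a : closed_form K n r) :
  @cohom_scale r c (coclass a) = coclass (F0_scale c a).
Proof.
apply/coclassP.
have -> : F0_scale c (repr (coclass a)) - F0_scale c a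
        = F0_scale c (repr (coclass a) - a).
  by apply: val_inj; rewrite /= -scalerBr.
by apply: exact_F0; apply/coclassP; rewrite /coclass reprK.
Qed.

Lemma cohom_scaleA r (b c : Kz) (h : H r) :
  cohom_scale b (cohom_scale c h) = cohom_scale (b * c) h.
Proof.
elim/coclassW: h => a; rewrite !cohom_scaleE; congr coclass; apply: val_inj.
by rewrite /= rmorphM scalerA.
Qed.

Lemma cohom_scale1 r : left_id 1 (@cohom_scale r).
Proof.
elim/coclassW=> a; rewrite !cohom_scaleE; congr coclass; apply: val_inj.
by rewrite /= rmorph1 scale1r.
Qed.

Lemma cohom_scaleDr r : right_distributive (@cohom_scale r) +%R.
Proof.
move=> c; elim/coclassW=> a; elim/coclassW=> b.
rewrite -[_ + _ in LHS]coclassD !cohom_scaleE -[RHS]coclassD.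
by congr coclass; apply: val_inj; rewrite /= -scalerDr.
Qed.

Lemma cohom_scaleDl r (h : H r) :
  {morph (@cohom_scale r)^~ h : b c / b + c}.
Proof.
elim/coclassW: h => a b c; rewrite !cohom_scaleE -[RHS]coclassD.
by congr coclass; apply: val_inj; rewrite /= rmorphD scalerDl.
Qed.

HB.instance Definition _ r := GRing.Zmodule_isLmodule.Build Kz (H r)
  (@cohom_scaleA r) (@cohom_scale1 r) (@cohom_scaleDr r) (@cohom_scaleDl r).

End FrobeniusAction.

Section DirectSum.
Variables (R : pzRingType) (m : nat) (V : 'I_m -> lmodType R).

Definition dsum := {dffun forall i, V i}.
HB.instance Definition _ := Choice.on dsum.
Implicit Types u v : dsum.

Definition dsum0 : dsum := [ffun i => 0].
Definition dsum_opp u : dsum := [ffun i => - u i].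
Definition dsum_add u v : dsum := [ffun i => u i + v i].
Definition dsum_scale (c : R) u : dsum := [ffun i => c *: u i].

Lemma dsum_addA : associative dsum_add.
Proof. by move=> u v w; apply/ffunP => i; rewrite !ffunE addrA. Qed.
Lemma dsum_addC : commutative dsum_add.
Proof. by move=> u v; apply/ffunP => i; rewrite !ffunE addrC. Qed.
Lemma dsum_add0 : left_id dsum0 dsum_add.
Proof. by move=> u; apply/ffunP => i; rewrite !ffunE add0r. Qed.
Lemma dsum_addN : left_inverse dsum0 dsum_opp dsum_add.
Proof. by move=> u; apply/ffunP => i; rewrite !ffunE addNr. Qed.

HB.instance Definition _ :=
  GRing.isZmodule.Build dsum dsum_addA dsum_addC dsum_add0 dsum_addN.

Lemma dsum_scaleA b c u : dsum_scale b (dsum_scale c u) = dsum_scale (b * c) u.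
Proof. by apply/ffunP => i; rewrite !ffunE scalerA. Qed.
Lemma dsum_scale1 : left_id 1 dsum_scale.
Proof. by move=> u; apply/ffunP => i; rewrite !ffunE scale1r. Qed.
Lemma dsum_scaleDr : right_distributive dsum_scale +%R.
Proof. by move=> c u v; apply/ffunP => i; rewrite !ffunE scalerDr. Qed.
Lemma dsum_scaleDl u : {morph dsum_scale^~ u : b c / b + c}.
Proof. by move=> b c; apply/ffunP => i; rewrite !ffunE scalerDl. Qed.

HB.instance Definition _ := GRing.Zmodule_isLmodule.Build R dsum
  dsum_scaleA dsum_scale1 dsum_scaleDr dsum_scaleDl.

End DirectSum.

Section Gamma.
Variables (K : fieldType) (p : nat) (charKp : p \in [pchar K]) (n : nat).
Local Notation Kz := (ratfun K n).
Local Notation F0 := (@F0 K n p charKp).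

(* Omega^r and H^r vanish for r > n, so the sums run over r = 0, ..., n. *)
Definition Omega := dsum (fun r : 'I_n.+1 => diff_form K n r : lmodType Kz).
Definition Hstar :=
  dsum (fun r : 'I_n.+1 => cohomF0 n charKp r : lmodType Kz).

HB.instance Definition _ := GRing.Lmodule.on Omega.
HB.instance Definition _ := GRing.Lmodule.on Hstar.

(* z_I^(p-1) *)
Definition zpow (I : {set 'I_n}) : Kz := \prod_(i in I) zvar K i ^+ p.-1.

Definition gamma_form r (a : diff_form K n r) : diff_form K n r :=
  \sum_(I : multiindex n r) (F0 (a I) * zpow (val I)) *: dz K r (val I).

Lemma gamma_formE r (a : diff_form K n r) I :
  gamma_form a I = F0 (a I) * zpow (val I).
Proof.
pose b : diff_form K n r := [ffun I => F0 (a I) * zpow (val I)].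
transitivity (b I); last by rewrite ffunE.
rewrite (form_dz b); apply: (congr1 (fun u : diff_form K n r => u I)).
by apply: eq_bigr => J _; rewrite [b J]ffunE.
Qed.

Lemma pderiv_zpow (j : 'I_n) (I : {set 'I_n}) :
  j \notin I -> pderiv j (zpow I) = 0.
Proof.
move=> jI; rewrite /zpow; elim/big_rec: _ => [|i x iI x0].
  by rewrite -(rmorph1 F0) pderiv_F0.
rewrite pderivM x0 mulr0 addr0 pderiv_zvar ?mul0r //.
by apply: contraNneq jI => ->.
Qed.

Lemma gamma_form_closed r (a : diff_form K n r) : gamma_form a \in @is_closed K n r.
Proof.
rewrite unfold_in /ext_deriv big1 // => I _; rewrite big1 // => j _.
rewrite gamma_formE /wedge_dz; case: ifPn => [_|jI]; first by rewrite scaler0.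
by rewrite pderivM pderiv_F0 pderiv_zpow // mul0r mulr0 addr0 scale0r.
Qed.

Definition gamma_deg r (a : diff_form K n r) : cohomF0 n charKp r :=
  coclass (ClosedForm (gamma_form_closed a)).

Definition gamma0 (a : Omega) : Hstar := [ffun r => gamma_deg (a r)].

End Gamma.

(* Main.v *)
Require Import Defs.
From HB Require Import structures.
From mathcomp Require Import all_boot all_order all_algebra.
From mathcomp Require Import boolp ring.
From mathcomp.multinomials Require Import mpoly.

Set Implicit Arguments.
Unset Strict Implicit.
Unset Printing Implicit Defensive.

Import GRing.Theory.
Local Open Scope ring_scope.

(* The Lie derivatives L_i along z_i d/dz_i commute with each other and with d,
   satisfy L_i^p = L_i because z_i d/dz_i acts on the monomial z^m by the scalar
   m_i in F_p, and are homotopic to 0 by the Cartan formula.  Hence the product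
   of the projections 1 - L_i^(p-1) changes a closed form by an exact one only.
   Its image, the common kernel of the L_i, consists of the forms gamma_form a,
   since the common constants of the d/dz_i are the a(z^p).  All these forms are
   closed, so surjectivity is immediate, and if gamma_form a = d b, then
   applying the projection to both sides gives gamma_form a = 0. *)

(** * Euler operators and the common constants of the partial derivatives *)

Lemma mcoeff_euler (K : fieldType) n (i : 'I_n) (u : {mpoly K[n]}) m :
  ('X_i * u^`M(i))@_m = (m i)%:R * u@_m.
Proof.
elim/mpolyind: u => [|c k u _ _ IH]; first by rewrite raddf0 mulr0 mcoeff0 mulr0.
rewrite mderivD mulrDr !mcoeffD mulrDr IH; congr (_ + _).
rewrite mderivZ mderivX -!scalerAr !mcoeffZ mcoeffX.
(* The exponent 0 is separate: the truncated subtraction of [U_(i)] can be undone only if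
   [k i > 0]. *)
have [k0|k0] := eqVneq (k i) 0%N.
  by rewrite k0 mul0r mulr0; case: eqVneq => [<-|_]; rewrite ?k0 ?mul0r ?mulr0.
have le_ik : (U_(i) <= k)%MM.
  by apply/mnm_lepP => j; rewrite mnm1E; case: eqVneq => [<-|//]; rewrite lt0n.
rewrite -mpolyXD addmC submK // mcoeffX.
by case: eqVneq => [->|_]; rewrite ?mulr0 // !mulr1 mulrC.
Qed.

Section Constants.
Variables (K : fieldType) (p : nat) (charKp : p \in [pchar K]) (n : nat).
Local Notation Kz := (ratfun K n).
Local Notation F0 := (@F0 K n p charKp).
Implicit Types (f g : Kz) (u v : {mpoly K[n]}) (i j : 'I_n).

Let p_gt0 : (0 < p)%N := prime_gt0 (pcharf_prime charKp).

Lemma mderiv_expp i u : (u ^+ p)^`M(i) = 0.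
Proof.
have D k : (u ^+ k.+1)^`M(i) = (u ^+ k * u^`M(i)) *+ k.+1.
  elim: k => [|k IH]; first by rewrite expr0 mul1r.
  by rewrite exprS mderivM IH mulrnAr mulrA -exprS -mulrC -mulrS.
rewrite -(prednK p_gt0) D prednK // -scaler_nat.
by rewrite (pcharf0 charKp) scale0r.
Qed.

(** By [mcoeff_euler], [m i] is zero in [K] for every [m] in the support, so [p] divides all
    exponents. *)
Lemma mderiv0_powsubst u : (forall i, u^`M(i) = 0) -> exists v, u = powsubst p v.
Proof.
move=> du; pose h (m : 'X_{1..n}) := [multinom (m i %/ p)%N | i < n].
exists (\sum_(m <- msupp u) u@_m *: 'X_[h m]).
rewrite raddf_sum [LHS]mpolyE; apply: eq_big_seq => m um.
rewrite [RHS]comp_mpolyZ; congr (_ *: _).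
rewrite [RHS](powsubstX K p (h m)).
congr ('X_[_]); apply/mnmP => i.
rewrite mulmnE mnmE divnK // (dvdn_pcharf charKp).
have /eqP := mcoeff_euler i u m; rewrite du mulr0 mcoeff0 eq_sym mulf_eq0.
by rewrite mcoeff_eq0 um orbF.
Qed.

Lemma F0_tofrac u : F0 u%:F = (powsubst p u)%:F.
Proof.
have -> : u%:F = u%:F / 1%:F by rewrite tofrac1 divr1.
rewrite /Defs.F0 fracmor_div ?oner_neq0 ?rmorph1 ?tofrac1 ?divr1 //.
exact: powsubst_inj.
Qed.

Lemma F0_zvar i : F0 (zvar K i) = zvar K i ^+ p.
Proof. by rewrite F0_tofrac powsubstX -mpolyXn tofracXn. Qed.

(* [x / y = x y^(p-1) / y^p], and [y^p] is a polynomial in [z^p]. *)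
Lemma ratfun_decomp f : exists u g, g != 0 /\ f = u%:F * F0 g.
Proof.
elim/fracW: f => x y y0; have [v yE] := mderiv0_powsubst (mderiv_expp ^~ y).
have v0 : v%:F != 0 :> Kz.
  rewrite tofrac_eq0; apply: contraNneq y0 => v0.
  by move/eqP: yE; rewrite v0 raddf0 expf_eq0 p_gt0.
exists (x * y ^+ p.-1), (v%:F)^-1; split; first by rewrite invr_eq0.
rewrite fmorphV /= F0_tofrac -yE; apply/eqP.
rewrite divF_eq ?expf_neq0 //.
by rewrite -mulrA -exprSr prednK.
Qed.

Lemma pderiv_tofrac i u : pderiv i u%:F = (u^`M(i))%:F.
Proof.
have -> : u%:F = u%:F / 1%:F by rewrite tofrac1 divr1.
rewrite /pderiv fracder_div ?oner_neq0 //; last exact: mderivM.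
by rewrite mulr1 -mpolyC1 mderivC mulr0 subr0 mpolyC1 expr1n tofrac1 divr1.
Qed.

Lemma pderivF0r i f g : pderiv i (f * F0 g) = pderiv i f * F0 g.
Proof. by rewrite pderivM pderiv_F0 mulr0 addr0. Qed.

(** Values of [F0] are constants, so [ratfun_decomp] reduces the claim to polynomials. *)
Lemma pderiv_comm i j f : pderiv i (pderiv j f) = pderiv j (pderiv i f).
Proof.
have [u [g [_ ->]]] := ratfun_decomp f.
by rewrite !(pderivF0r, pderiv_tofrac) mderiv_comm.
Qed.

Lemma pderiv0_F0 f : (forall i, pderiv i f = 0) -> exists g, f = F0 g.
Proof.
have [u [g [g0 ->]]] := ratfun_decomp f => df.
have /mderiv0_powsubst[v ->] : forall i, u^`M(i) = 0.
  move=> i; move/eqP: (df i).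
  rewrite pderivF0r pderiv_tofrac mulf_eq0 fmorph_eq0 (negPf g0) orbF.
  by rewrite tofrac_eq0 => /eqP.
by exists (v%:F * g); rewrite rmorphM /= F0_tofrac.
Qed.

Definition euler i f : Kz := zvar K i * pderiv i f.

Lemma zvar_neq0 i : zvar K i != 0.
Proof. by rewrite tofrac_eq0 -msupp_eq0 msuppX. Qed.

Lemma euler_iterp i f : iter p (euler i) f = euler i f.
Proof.
have [u [g [_ ->]]] := ratfun_decomp f.
pose E v := 'X_i * v^`M(i).
have eE v : euler i (v%:F * F0 g) = (E v)%:F * F0 g.
  by rewrite /euler pderivF0r pderiv_tofrac mulrA -tofracM.
have -> : iter p (euler i) (u%:F * F0 g) = (iter p E u)%:F * F0 g.
  (* Only the two iteration counts are generalised, not the [p] inside [F0]. *)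
  by elim: {1 3}p => //= k ->; rewrite eE.
rewrite eE; congr (_%:F * _); apply/mpolyP => m.
have iterE k : (iter k E u)@_m = (m i)%:R ^+ k * u@_m.
  by elim: k => [|k IH]; rewrite ?expr0 ?mul1r //= mcoeff_euler IH mulrA exprS.
rewrite iterE mcoeff_euler; congr (_ * _).
(* The eigenvalue [m i] lies in the prime field, which Frobenius fixes. *)
exact: (pFrobenius_aut_nat charKp).
Qed.

Lemma euler_comm i j f : euler i (euler j f) = euler j (euler i f).
Proof.
have [->//|ij] := eqVneq i j.
rewrite /euler !(pderivM _ (zvar K _)) pderiv_comm -[zvar K j]expr1 -[zvar K i]expr1.
by rewrite !pderiv_zvar // 1?eq_sym // !mul0r !add0r mulrCA.
Qed.

End Constants.

(** * Lie derivatives on coefficients *)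

Section LieDerivative.
Variables (K : fieldType) (p : nat) (charKp : p \in [pchar K]) (n : nat).
Local Notation Kz := (ratfun K n).
Local Notation z := (zvar K).
Implicit Types (f g : Kz) (i j : 'I_n) (I J : {set 'I_n}).
Implicit Type c : {set 'I_n} -> Kz.

Lemma pderiv_zvarM i j f : i != j -> pderiv j (z i * f) = z i * pderiv j f.
Proof.
by move=> ij; rewrite [LHS]pderivM -[z i]expr1 pderiv_zvar 1?eq_sym // mul0r add0r.
Qed.

Definition zprod J : Kz := \prod_(j in J) z j.

Lemma zprod_neq0 J : zprod J != 0.
Proof. by apply/prodf_neq0 => j _; apply: zvar_neq0. Qed.

Lemma pderiv_zprod i J : i \notin J -> pderiv i (zprod J) = 0.
Proof.
move=> iJ; rewrite /zprod; elim/big_rec: _ => [|j x jJ x0].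
  by rewrite -tofrac1 pderiv_tofrac -mpolyC1 mderivC tofrac0.
rewrite pderivM x0 mulr0 addr0 -[z j]expr1 pderiv_zvar ?mul0r //.
by apply: contraNneq iJ => ->.
Qed.

(* The coefficient of dz_J in the Lie derivative of f dz_J along z_i d/dz_i:
   z_J^-1 dz_J is invariant under all these fields. *)
Definition lie_coef i J f : Kz := (zprod J)^-1 * euler i (zprod J * f).

Lemma lie_coef_is_zmod_morphism i J : zmod_morphism (lie_coef i J).
Proof. by move=> f g; rewrite /lie_coef /euler mulrBr raddfB !mulrBr. Qed.

HB.instance Definition _ i J :=
  GRing.isZmodMorphism.Build Kz Kz (lie_coef i J) (lie_coef_is_zmod_morphism i J).

(** In [zprod J] only a factor [z i] is not constant for [pderiv i]; the other factors cancel. *)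
Lemma lie_coefE i J f :
  lie_coef i J f = if i \in J then pderiv i (z i * f) else z i * pderiv i f.
Proof.
rewrite /lie_coef /euler; case: ifPn => iJ.
  have -> : zprod J = z i * zprod (J :\ i).
    by rewrite /zprod (big_setD1 i).
  rewrite -mulrA (mulrCA (z i) _ f) (pderivM i (zprod _)).
  rewrite pderiv_zprod ?setD11 // mul0r add0r.
  by rewrite [X in _ * X]mulrA mulKf ?mulf_neq0 ?zvar_neq0 ?zprod_neq0.
rewrite (pderivM i (zprod _)) pderiv_zprod // mul0r add0r.
by rewrite (mulrCA (z i)) mulKf ?zprod_neq0.
Qed.

Lemma lie_coef_iter i J k f :
  iter k (lie_coef i J) f = (zprod J)^-1 * iter k (euler i) (zprod J * f).
Proof.
elim: k => [|k /= ->]; first by rewrite mulKf ?zprod_neq0.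
by rewrite /lie_coef mulVKf ?zprod_neq0.
Qed.

Lemma lie_coef_iterp i J f : iter p (lie_coef i J) f = lie_coef i J f.
Proof. by rewrite lie_coef_iter (euler_iterp charKp). Qed.

Lemma lie_coef_comm i j J f :
  lie_coef i J (lie_coef j J f) = lie_coef j J (lie_coef i J f).
Proof.
by rewrite /lie_coef !(mulVKf (zprod_neq0 J)) (euler_comm charKp i j).
Qed.

(** This is the termwise reason why Lie derivatives commute with d. For [i = j] both sides are
    [pderiv j (z j * pderiv j f)]. *)
Lemma pderiv_lie_coef i j J f : j \in J ->
  pderiv j (lie_coef i (J :\ j) f) = lie_coef i J (pderiv j f).
Proof.
move=> jJ; rewrite !lie_coefE in_setD1.
have [->|ij] /= := eqVneq i j; first by rewrite jJ.
by case: ifP => _; rewrite ?(pderiv_zvarM _ ij) (pderiv_comm charKp) ?(pderiv_zvarM _ ij).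
Qed.

(** * Signs and the Cartan formula *)

Definition wedge_sign j I : Kz := (-1) ^+ #|[set i in I | (i < j)%N]|.

Lemma wedge_sign_sqr j I : wedge_sign j I * wedge_sign j I = 1.
Proof. by rewrite /wedge_sign -expr2 sqrr_sign. Qed.

Lemma wedge_signD1 j I : wedge_sign j (I :\ j) = wedge_sign j I.
Proof.
rewrite /wedge_sign; congr (_ ^+ _); apply: eq_card => i.
by rewrite !inE; case: (eqVneq i j) => // ->; rewrite ltnn !andbF.
Qed.

Lemma wedge_signU1 j I : wedge_sign j (j |: I) = wedge_sign j I.
Proof.
rewrite /wedge_sign; congr (_ ^+ _); apply: eq_card => i.
by rewrite !inE; case: (eqVneq i j) => // ->; rewrite ltnn !andbF.
Qed.

Lemma wedge_signU i j I : i \notin I ->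
  wedge_sign j (i |: I) = (-1) ^+ (i < j)%N * wedge_sign j I.
Proof.
move=> iI; rewrite /wedge_sign -exprD; congr (_ ^+ _).
case: ltnP => ij.
  have -> : [set k in i |: I | (k < j)%N] = i |: [set k in I | (k < j)%N].
    by apply/setP => k; rewrite !inE; case: eqVneq => // ->; rewrite ij.
  by rewrite cardsU1 inE (negPf iI).
apply: eq_card => k.
by rewrite !inE; case: (eqVneq k i) => // ->; rewrite ltnNge ij /= andbF.
Qed.

(** Exactly one of [i < j] and [j < i] holds, whence the minus sign; it cancels the mixed terms in
    [cartan]. *)
Lemma wedge_sign_swap i j J : i \notin J -> j \in J ->
  wedge_sign j J * wedge_sign i (J :\ j) =
  - (wedge_sign j (i |: J) * wedge_sign i J).
Proof.
move=> iJ jJ; have ij : i != j by apply: contraNneq iJ => ->.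
have -> : wedge_sign i J = wedge_sign i (j |: (J :\ j)) by rewrite setD1K.
rewrite !wedge_signU ?setD11 //.
suff -> : (-1) ^+ (i < j)%N = - (-1) ^+ (j < i)%N :> Kz.
  by rewrite !mulNr opprK mulrACA -expr2 sqrr_sign mul1r.
by case: ltngtP => [//|//|/val_inj/eqP]; rewrite ?expr1 ?expr0 ?opprK // (negPf ij).
Qed.

(* The exterior derivative and the contraction with z_i d/dz_i, on families of
   coefficients of forms of mixed degree. *)
Definition coef_deriv c J : Kz :=
  \sum_(j in J) wedge_sign j J * pderiv j (c (J :\ j)).

Definition coef_contract i c J : Kz :=
  if i \in J then 0 else wedge_sign i J * (z i * c (i |: J)).

(** If [i \in J], the second summand is 0 and only [j = i] survives in the first. Otherwise the term
    [j = i] of the second gives the right-hand side, and the terms with [j \in J] cancel in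
    pairs. *)
Lemma cartan i c J :
  coef_deriv (coef_contract i c) J + coef_contract i (coef_deriv c) J
  = lie_coef i J (c J).
Proof.
have sgM j I f : pderiv j (wedge_sign i I * f) = wedge_sign i I * pderiv j f.
  by rewrite /wedge_sign -signr_odd !mulr_sign; case: odd; rewrite ?raddfN.
rewrite lie_coefE {1}/coef_deriv {2}/coef_contract; case: ifPn => iJ.
  rewrite addr0 (bigD1 i) //= big1 ?addr0 => [|j /andP[_ ji]].
    rewrite /coef_contract setD11 setD1K // sgM mulrA wedge_signD1.
    by rewrite wedge_sign_sqr mul1r.
  by rewrite /coef_contract in_setD1 iJ eq_sym ji raddf0 mulr0.
rewrite /coef_deriv big_setU1 //= setU1K // wedge_signU1.
have splitE s x y : s * s = 1 -> s * (z i * (s * x + y)) = z i * x + s * (z i * y).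
  move=> ss.
  have -> : s * (z i * (s * x + y)) = s * s * (z i * x) + s * (z i * y) by ring.
  by rewrite ss mul1r.
rewrite splitE ?wedge_sign_sqr // addrCA -[RHS]addr0; congr (_ + _).
rewrite !mulr_sumr -big_split big1 //= => j jJ.
have ij : i != j by apply: contraNneq iJ => ->.
rewrite /coef_contract in_setD1 (negPf iJ) andbF sgM.
rewrite pderiv_zvarM // mulrA wedge_sign_swap //.
have -> : (i |: J) :\ j = i |: (J :\ j).
  by apply/setP => k; rewrite !inE; case: (eqVneq k i) => // ->; rewrite ij.
by ring.
Qed.

Lemma coef_deriv_lie i c J :
  coef_deriv (fun I => lie_coef i I (c I)) J = lie_coef i J (coef_deriv c J).
Proof.
rewrite /coef_deriv raddf_sum; apply: eq_bigr => j jJ.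
rewrite pderiv_lie_coef // /wedge_sign -signr_odd !mulr_sign.
by case: odd; rewrite ?raddfN.
Qed.


(** * The common kernel of the Lie derivatives and the projection onto it *)

Lemma lie_coef_iter_comm i j J k f :
  lie_coef i J (iter k (lie_coef j J) f) = iter k (lie_coef j J) (lie_coef i J f).
Proof. by elim: k => //= k <-; rewrite lie_coef_comm. Qed.

(** This accounts for the exponent [p - 1]: multiplied by [zprod J], a coefficient of [gamma_form]
    becomes a value of [F0]. *)
Lemma F0_zprod J : F0 charKp (zprod J) = zprod J * zpow K p J.
Proof.
rewrite rmorph_prod /= -big_split; apply: eq_bigr => j _ /=.
by rewrite (F0_zvar charKp) -exprS prednK // prime_gt0 // (pcharf_prime charKp).
Qed.

Lemma lie_coef_iter0 i J k : iter k (lie_coef i J) 0 = 0.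
Proof. by elim: k => //= k ->; rewrite raddf0. Qed.

Lemma lie_coef_eq0 J f : (forall i, lie_coef i J f = 0) ->
  exists g, f = F0 charKp g * zpow K p J.
Proof.
move=> lf0; have [i|g fE] := @pderiv0_F0 _ _ charKp n (zprod J * f).
  move: (lf0 i); rewrite /lie_coef /euler; move: (pderiv i _) => d /eqP.
  by rewrite !mulf_eq0 invr_eq0 (negPf (zprod_neq0 J)) (negPf (zvar_neq0 K i)) => /eqP.
(* Since [zprod J * f = F0 g], dividing by [F0 (zprod J)] leaves [f / zpow J]. *)
exists (g / zprod J); rewrite rmorphM /= fmorphV /= -fE F0_zprod.
have z0 : zpow K p J != 0.
  by apply/prodf_neq0 => j _; rewrite expf_neq0 ?zvar_neq0.
by rewrite -mulf_div divff ?zprod_neq0 // mul1r divfK.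
Qed.

Lemma lie_coef_gamma i J g : lie_coef i J (F0 charKp g * zpow K p J) = 0.
Proof.
by rewrite /lie_coef (mulrCA (zprod J)) -F0_zprod -rmorphM /= /euler pderiv_F0 !mulr0.
Qed.

(** As [p >= 2], the power [p - 1] of a Lie derivative contains at least one factor, so it vanishes
    on the kernel. *)
Let predn2K : p.-2.+1 = p.-1.
Proof. by rewrite prednK // ltn_predRL prime_gt1 // (pcharf_prime charKp). Qed.

(* Since lie_coef i J is equal to its p-th power, this is the projection onto
   its kernel. *)
Definition lie_proj i c J : Kz := c J - iter p.-1 (lie_coef i J) (c J).

Lemma lie_coef_proj i c J : lie_coef i J (lie_proj i c J) = 0.
Proof.
rewrite raddfB /= -iterS prednK ?lie_coef_iterp ?subrr //.
exact: prime_gt0 (pcharf_prime charKp).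
Qed.

Lemma lie_coef_proj0 i j c J : lie_coef i J (c J) = 0 ->
  lie_coef i J (lie_proj j c J) = 0.
Proof.
by move=> c0; rewrite raddfB /= lie_coef_iter_comm c0 lie_coef_iter0 subr0.
Qed.

Lemma lie_proj_id i c J : lie_coef i J (c J) = 0 -> lie_proj i c J = c J.
Proof.
by move=> c0; rewrite /lie_proj -predn2K iterSr c0 lie_coef_iter0 subr0.
Qed.

Lemma coef_derivB c c' J :
  coef_deriv (fun I => c I - c' I) J = coef_deriv c J - coef_deriv c' J.
Proof. by rewrite -sumrB; apply: eq_bigr => j _; rewrite raddfB mulrBr. Qed.

Lemma coef_derivD c c' J :
  coef_deriv (fun I => c I + c' I) J = coef_deriv c J + coef_deriv c' J.
Proof. by rewrite -big_split; apply: eq_bigr => j _; rewrite raddfD mulrDr. Qed.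

Lemma coef_deriv_iter_lie i k c J :
  coef_deriv (fun I => iter k (lie_coef i I) (c I)) J
  = iter k (lie_coef i J) (coef_deriv c J).
Proof. by elim: k => //= k <-; rewrite coef_deriv_lie. Qed.

Lemma coef_deriv_proj i c J : coef_deriv (lie_proj i c) J = lie_proj i (coef_deriv c) J.
Proof. by rewrite coef_derivB coef_deriv_iter_lie. Qed.

(* On closed forms the Cartan formula makes the image of a Lie derivative exact. *)
Lemma lie_proj_exact i c : coef_deriv c =1 (fun=> 0) ->
  exists e, forall J, c J - lie_proj i c J = coef_deriv e J.
Proof.
(* Applying the Lie derivative once more to [b] gives its power [p - 1] on [c], and [b] is closed
   like [c]; so contracting [b] yields a primitive. *)
move=> dc0; pose b I := iter p.-2 (lie_coef i I) (c I).
exists (coef_contract i b) => J.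
have -> : c J - lie_proj i c J = lie_coef i J (b J).
  by rewrite subKr -predn2K.
rewrite -cartan -[RHS]addr0; congr (_ + _).
rewrite /coef_contract; case: ifP => // _.
by rewrite coef_deriv_iter_lie dc0 lie_coef_iter0 !mulr0.
Qed.

Definition kernel_proj c : {set 'I_n} -> Kz := foldr lie_proj c (enum 'I_n).

(** The projection for [i] kills its own Lie derivative, and the projections applied after it
    preserve this by commutativity. *)
Lemma lie_coef_kernel_proj i c J : lie_coef i J (kernel_proj c J) = 0.
Proof.
have : i \in enum 'I_n by rewrite mem_enum.
rewrite /kernel_proj; elim: (enum _) => //= j s IH; rewrite inE.
have [<- _|_ /= /IH] := eqVneq i j; first exact: lie_coef_proj.
exact: lie_coef_proj0.
Qed.

Lemma kernel_proj_id c J : (forall i, lie_coef i J (c J) = 0) -> kernel_proj c J = c J.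
Proof.
move=> c0; rewrite /kernel_proj; elim: (enum _) => //= j s IH.
by rewrite lie_proj_id IH.
Qed.

Lemma coef_deriv_kernel_proj c J :
  coef_deriv (kernel_proj c) J = kernel_proj (coef_deriv c) J.
Proof.
rewrite /kernel_proj; elim: (enum _) J => //= j s IH J.
by rewrite coef_deriv_proj /lie_proj IH.
Qed.

Lemma kernel_proj_exact c : coef_deriv c =1 (fun=> 0) ->
  exists e, forall J, c J - kernel_proj c J = coef_deriv e J.
Proof.
move=> dc0; rewrite /kernel_proj.
(* The induction also carries closedness of the partial projection, which [lie_proj_exact]
   requires. *)
suff [] : coef_deriv (foldr lie_proj c (enum 'I_n)) =1 (fun=> 0) /\
    exists e, forall J, c J - foldr lie_proj c (enum 'I_n) J = coef_deriv e J by [].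
elim: (enum _) => [|j s [ds0 [e eE]]] /=.
  split=> //; exists (fun=> 0) => J; rewrite subrr /coef_deriv big1 // => j _.
  by rewrite raddf0 mulr0.
split=> [J|]; first by rewrite coef_deriv_proj /lie_proj ds0 lie_coef_iter0 subr0.
have [e' e'E] := lie_proj_exact j ds0; exists (fun I => e I + e' I) => J.
by rewrite coef_derivD -eE -e'E addrA subrK.
Qed.

End LieDerivative.

(** * From families of coefficients to forms and cohomology classes *)

Section Cartier.
Variables (K : fieldType) (p : nat) (charKp : p \in [pchar K]) (n : nat).
Local Notation Kz := (ratfun K n).
Local Notation gamma_deg r := (@gamma_deg K p charKp n r).
Implicit Types (r : nat) (i j : 'I_n) (J : {set 'I_n}).

(** Extension by 0 to subsets of every size frees the calculus from degrees. *)
Definition form_coef r (a : diff_form K n r) J : Kz :=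
  oapp a 0 (insub J : option (multiindex n r)).

Lemma form_coef_val r (a : diff_form K n r) (I : multiindex n r) :
  form_coef a (val I) = a I.
Proof. by rewrite /form_coef valK. Qed.

Lemma form_coef_out r (a : diff_form K n r) J : #|J| != r -> form_coef a J = 0.
Proof. by move=> J_r; rewrite /form_coef insubF //; apply: negbTE. Qed.

(** For each [j] in [J], only [I = J :\ j] contributes to the coefficient at [J]. *)
Lemma ext_derivE r (a : diff_form K n r) (J : multiindex n r.+1) :
  ext_deriv a J = coef_deriv (form_coef a) (val J).
Proof.
rewrite /ext_deriv sum_ffunE.
under eq_bigr do rewrite sum_ffunE.
rewrite exchange_big /coef_deriv [RHS]big_mkcond; apply: eq_bigr => j _ /=.
case: ifPn => jJ; last first.
  rewrite big1 // => I _; rewrite ffunE /wedge_dz; case: ifPn => jI.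
    by rewrite ffunE; apply: mulr0.
  rewrite !ffunE; case: eqP => [JE|_]; last by rewrite !scaler0.
  by rewrite JE setU11 in jJ.
have DJ : #|val J :\ j| == r.
  by have := valP J; rewrite /= (cardsD1 j) jJ.
pose I0 : multiindex n r := Sub (val J :\ j) DJ.
rewrite (bigD1 I0) //= big1 ?addr0 => [|I II0].
  rewrite -[val J :\ j]/(val I0) form_coef_val.
  rewrite ffunE /wedge_dz setD11 !ffunE setD1K // eqxx.
  rewrite -/(wedge_sign _ _ _) wedge_signD1 mulrC.
  by congr (_ * _); apply: mulr1.
rewrite ffunE /wedge_dz; case: ifPn => jI; first by rewrite ffunE; apply: mulr0.
rewrite !ffunE; case: eqP => [JE|_]; last by rewrite !scaler0.
by case/eqP: II0; apply: val_inj; rewrite /= JE setU1K.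
Qed.

Lemma coef_deriv_closed r (a : diff_form K n r) : a \in @is_closed K n r ->
  coef_deriv (form_coef a) =1 (fun=> 0).
Proof.
rewrite unfold_in => /eqP a0 J; have [Jr|Jr] := eqVneq #|J| r.+1.
  have J_r : #|J| == r.+1 by apply/eqP.
  by rewrite -[J]/(val (Sub J J_r : multiindex n r.+1)) -ext_derivE a0 ffunE.
rewrite /coef_deriv big1 // => j jJ; rewrite form_coef_out ?raddf0 ?mulr0 //.
by apply: contraNneq Jr => <-; rewrite (cardsD1 j J) jJ.
Qed.

(** A primitive may have mixed degree: at sets of size [r.+1] only its values at sets of size [r]
    count. In degree 0 the sum is empty, in accordance with [B^0 = 0]. *)
Lemma is_exactP r (a : diff_form K n r) :
  is_exact a <-> exists c, forall I : multiindex n r, a I = coef_deriv c (val I).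
Proof.
case: r a => [|r] a /=; split.
- move=> ->; exists (fun=> 0) => I; rewrite ffunE /coef_deriv big1 // => j _.
  by rewrite raddf0 mulr0.
- move=> [c aE]; apply/ffunP => I; rewrite aE ffunE /coef_deriv big1 // => j.
  by rewrite (cards0_eq (eqP (valP I))) inE.
- by move=> [b ->]; exists (form_coef b) => I; rewrite ext_derivE.
move=> [c aE]; exists [ffun I => c (val I)]; apply/ffunP => J.
rewrite ext_derivE aE; apply: eq_bigr => j jJ; congr (_ * pderiv j _).
have DJ : #|val J :\ j| == r.
  by have := valP J; rewrite /= (cardsD1 j) jJ.
pose I0 : multiindex n r := Sub (val J :\ j) DJ.
by rewrite -[_ :\ _]/(val I0) form_coef_val ffunE.
Qed.

Lemma kernel_proj_gamma c J :
  exists g, kernel_proj p c J = F0 charKp g * zpow K p J.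
Proof. by apply: lie_coef_eq0 => i; apply: lie_coef_kernel_proj. Qed.

(** The coefficient at [J :\ j] is a constant times a product without [z_j], so [pderiv j] kills
    it. *)
Lemma coef_deriv_kernel_proj0 c : coef_deriv (kernel_proj p c) =1 (fun=> 0 : Kz).
Proof.
move=> J; rewrite /coef_deriv big1 // => j jJ.
have [g ->] := kernel_proj_gamma c (J :\ j).
by rewrite pderivM pderiv_F0 (pderiv_zpow charKp) ?setD11 // mul0r !mulr0 addr0 mulr0.
Qed.

Lemma gamma_deg_linear r : linear (gamma_deg r).
Proof.
move=> c a b; rewrite /Defs.gamma_deg [X in _ = X + _]cohom_scaleE -[RHS]coclassD.
congr coclass; apply: val_inj; apply/ffunP => I.
rewrite /= [RHS]ffunE [X in _ = X + _]ffunE !gamma_formE !ffunE rmorphD rmorphM.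
by rewrite /= mulrDl -mulrA.
Qed.

Lemma gamma_deg_inj r : injective (gamma_deg r).
Proof.
move=> a b ab; apply/eqP; rewrite -subr_eq0; apply/eqP.
have /coclassP := ab; rewrite unfold_in => /asboolP /is_exactP[c cE].
apply/ffunP => I; rewrite ffunE.
have lie0 i : lie_coef i (val I) (coef_deriv c (val I)) = 0.
  by rewrite -cE /= !ffunE !gamma_formE -mulrBl -rmorphB lie_coef_gamma.
(* The projection fixes this exact form, but it commutes with d and has closed image, so it also
   sends the form to 0. *)
have := kernel_proj_id charKp lie0.
rewrite -coef_deriv_kernel_proj // coef_deriv_kernel_proj0 -cE /= !ffunE.
rewrite !gamma_formE -mulrBl -rmorphB => /esym/eqP; rewrite mulf_eq0.
have /negPf-> : zpow K p (val I) != 0.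
  by apply/prodf_neq0 => j _; rewrite expf_neq0 ?zvar_neq0.
by rewrite orbF fmorph_eq0 => /eqP.
Qed.

Lemma gamma_deg_surj r (h : cohomF0 n charKp r) : exists a, gamma_deg r a = h.
Proof.
elim/coclassW: h => a.
have a_closed := coef_deriv_closed (valP a).
have [e eE] := kernel_proj_exact charKp a_closed.
have [g gE] := choice (kernel_proj_gamma (form_coef (val a))).
(* The preimage is read off from the projection of [a], which differs from [a] by the exact form
   with primitive [e]. *)
exists [ffun I => g (val I)]; apply/esym/coclassP.
rewrite unfold_in; apply/asboolP/is_exactP; exists e => I.
by rewrite -eE form_coef_val gE /= !ffunE gamma_formE ffunE.
Qed.

End Cartier.

Theorem theorem2 (K : fieldType) (p : nat) (charKp : p \in [pchar K]) (n : nat) :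
  linear (@gamma0 K p charKp n) /\ bijective (@gamma0 K p charKp n).
Proof.
split=> [c a b|].
  by apply/ffunP => r; rewrite !ffunE gamma_deg_linear.
(* [bijective] asks for an inverse function, so preimages are chosen in each degree. *)
pose G r := choice (@gamma_deg_surj K p charKp n r).
pose g (h : Hstar charKp n) : Omega K n :=
  [ffun r : 'I_n.+1 => projT1 (G r) (h r)].
exists g => [a|h].
  by apply/ffunP => r; rewrite !ffunE; apply: gamma_deg_inj (projT2 (G r) _).
by apply/ffunP => r; rewrite !ffunE; apply: projT2 (G r) _.
Qed.
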